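(* Let $d=2^n$, $k\ge1$, let $\mathcal{E}=\{p_j,U_j\}$ be an ensemble of unitary operators on $\mathbb{C}^d$, and fix $n$-qubit Pauli operators $B_1,\dots,B_k\in\mathcal{P}$. Let $\gamma_{C_1,\dots,C_k}$ be the coefficients in the Pauli expansion of the $k$-fold channel output, $$\Phi^{(k)}_{\mathcal{E}}(B_1\otimes\cdots\otimes B_k)=\sum_{C_1,\dots,C_k\in\mathcal{P}}\gamma_{C_1,\dots,C_k}\,C_1\otimes\cdots\otimes C_k,$$ and for $A_1,\dots,A_k\in\mathcal{P}$ let $\alpha_{A_1,\dots,A_k}=\langle A_1\tilde B_1\cdots A_k\tilde B_k\rangle_{\mathcal{E}}$ be the ensemble-averaged $2k$-point out-of-time-order correlator. Then the correlators determine the channel: for all $C_1,\dots,C_k\in\mathcal{P}$, $$\gamma_{C_1,\dots,C_k}=\frac{1}{d^{2k-1}}\sum_{A_1,\dots,A_k\in\mathcal{P}}\overline{\mathrm{tr}\{A_1C_1A_2C_2\cdots A_kC_k\}}\;\alpha_{A_1,\dots,A_k}.$$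
   Context: $\mathcal{P}$ denotes the set of the $4^n=d^2$ operators $P_1\otimes\cdots\otimes P_n$ with each $P_j\in\{I,X,Y,Z\}$ (no global phases). An ensemble $\mathcal{E}=\{p_j,U_j\}$ consists of unitaries $U_j$ on $\mathbb{C}^d$ with probabilities $p_j\ge0$, $\sum_jp_j=1$. The $k$-fold channel is $\Phi^{(k)}_{\mathcal{E}}(\rho)=\sum_jp_j\,(U_j^{\dagger})^{\otimes k}\rho\,U_j^{\otimes k}$ for operators $\rho$ on $(\mathbb{C}^d)^{\otimes k}$. The averaged correlator is $\langle A_1\tilde B_1\cdots A_k\tilde B_k\rangle_{\mathcal{E}}=\sum_jp_j\,\frac1d\mathrm{tr}\{A_1U_j^\dagger B_1U_j\cdots A_kU_j^\dagger B_kU_j\}$. *)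

(* Defs.v *)
From mathcomp Require Import all_boot all_order all_algebra.
From mathcomp Require Import sesquilinear spectral.
From mathcomp Require Import reals complex mxtens.

Set Implicit Arguments.
Unset Strict Implicit.
Unset Printing Implicit Defensive.

Import Order.TTheory GRing.Theory Num.Theory.

Local Open Scope ring_scope.
Local Open Scope complex_scope.

(* A_0 *t A_1 *t ... *t A_(k-1), associated to the right and with the same     *)
(* special case at k = 1 as ntensmx, so that a constant family gives A ^t k.   *)
Fixpoint tensmx_fam_rec (C : pzRingType) (d k : nat) :
    ('I_k.+1 -> 'M[C]_d) -> 'M[C]_(d ^ k.+1) :=
  if k is k'.+1 then
    fun A => A ord0 *t tensmx_fam_rec (fun i : 'I_k'.+1 => A (lift ord0 i))
  else fun A => A ord0.

Definition tensmx_fam (C : pzRingType) (d k : nat) :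
    ('I_k -> 'M[C]_d) -> 'M[C]_(d ^ k) :=
  if k is k'.+1 then fun A => tensmx_fam_rec A else fun=> 1%:M.

Definition mx22 (C : pzRingType) (a b c d : C) : 'M[C]_2 :=
  \matrix_(i, j) (if i == 0 then if j == 0 then a else b
                  else if j == 0 then c else d).

Definition pauli1 (C : numClosedFieldType) (s : 'I_4) : 'M[C]_2 :=
  tnth [tuple mx22 1 0
                   0 1;
              mx22 0 1
                   1 0;
              mx22 0 (- 'i)
                   'i 0;
              mx22 1 0
                   0 (-1)] s.

(* The strings index the n-qubit Pauli operators; pauli is injective on them,  *)
(* so a sum over strings is a sum over the 4 ^ n operators.                    *)
Notation pauli_string n := {ffun 'I_n -> 'I_4}.

Definition pauli (C : numClosedFieldType) (n : nat) (s : pauli_string n) :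
    'M[C]_(2 ^ n) :=
  tensmx_fam (fun j => pauli1 C (s j)).

Definition kfold_channel (R : realType) (d : nat) (J : finType)
    (p : J -> R) (U : J -> 'M[R[i]]_d) (k : nat) (rho : 'M[R[i]]_(d ^ k)) :
    'M[R[i]]_(d ^ k) :=
  \sum_j (p j)%:C *: ((((U j)^t*)%sesqui ^t k) *m rho *m (U j ^t k)).

(* The product over 'I_k is taken in increasing order of the index.            *)
Definition otoc (R : realType) (d : nat) (J : finType)
    (p : J -> R) (U : J -> 'M[R[i]]_d) (k : nat)
    (A B : 'I_k -> 'M[R[i]]_d) : R[i] :=
  \sum_j (p j)%:C *
    (d%:R^-1 * \tr (\prod_(i < k) (A i *m (((U j)^t*)%sesqui *m B i *m U j)))).

(* Main.v *)
(** The n-qubit Paulis [P_s] satisfy the completeness relation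
    [sum_s P_s (x) conj P_s = d |bell><bell|], where [|bell> = sum_i |i, i>].
    Hence, for arbitrary slots [V_i], [W_i], the sum over [A] of
    [conj (tr prod_i A_i W_i) * tr prod_i A_i V_i], read as the trace of an
    ordered product on the doubled space, collapses to
    [d^k prod_i tr (W_i^* V_i)].  With [W_i = C_i] and [V_i = U_j^* B_i U_j] and
    averaged over [j], the right-hand side is [d^k] times the Hilbert-Schmidt
    product of [C_1 (x) ... (x) C_k] with the channel output, which is
    [d^k gamma_C] by orthogonality of the Paulis. *)

Require Import Defs.
From mathcomp Require Import all_boot all_order all_algebra.
From mathcomp Require Import sesquilinear spectral.
From mathcomp Require Import reals complex mxtens ring.

Import Order.TTheory GRing.Theory Num.Theory.

Local Open Scope ring_scope.
Local Open Scope complex_scope.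
Local Open Scope sesquilinear_scope.

(* Base-d digits of an index of a k-fold tensor power, most significant first. *)
Fixpoint tensmx_digits_rec (d k : nat) :
    'I_(d ^ k.+1) -> {ffun 'I_k.+1 -> 'I_d} :=
  if k is k'.+1 then
    fun a => let ab := @mxtens_unindex d (d ^ k'.+1) a in
      [ffun i => if unlift ord0 i is Some j then tensmx_digits_rec d k' ab.2 j
                 else ab.1]
  else fun a => [ffun=> a].

Definition tensmx_digits (d k : nat) : 'I_(d ^ k) -> {ffun 'I_k -> 'I_d} :=
  if k is k'.+1 then tensmx_digits_rec d k'
  else fun=> ffun0 (card_ord 0).

Lemma tensmx_digits_inj (d k : nat) : injective (tensmx_digits d k).
Proof.
case: k => [|k] /=; first by move=> a b _; rewrite [a]ord1 [b]ord1.
elim: k => [|k IH] a b /= /ffunP E.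
  by have := E ord0; rewrite !ffunE.
apply: (can_inj (@mxtens_unindexK d (d ^ k.+1))).
rewrite [LHS]surjective_pairing [RHS]surjective_pairing; congr (_, _).
  by have := E ord0; rewrite !ffunE unlift_none.
apply: IH; apply/ffunP => i.
by have := E (lift ord0 i); rewrite !ffunE !liftK.
Qed.

Lemma tensmx_digits_bij (d k : nat) : bijective (tensmx_digits d k).
Proof.
apply: inj_card_bij; first exact: tensmx_digits_inj.
by rewrite card_ffun !card_ord.
Qed.

(** * Entrywise calculus of tensor products of families of matrices *)

Section TensorFamily.
Context {F : numClosedFieldType} {d k : nat}.
Implicit Types A B : 'I_k -> 'M[F]_d.

(** Digits flatten the nested Kronecker product, so the multiplication, adjoint and trace rules
    below become rearrangements of scalar sums and products. *)
Lemma tensmx_famE A a b :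
  tensmx_fam A a b =
  \prod_i A i (tensmx_digits d k a i) (tensmx_digits d k b i).
Proof.
case: k A a b => [|k'] A a b; first by rewrite big_ord0 mxE [a]ord1 [b]ord1.
rewrite /tensmx_fam /tensmx_digits.
elim: k' A a b => [|k' IH] A a b;
  first by rewrite big_ord_recl big_ord0 !ffunE mulr1.
rewrite /= mxE IH [RHS]big_ord_recl !ffunE unlift_none; congr (_ * _).
by apply: eq_bigr => i _; rewrite !ffunE liftK.
Qed.

(** Reindexing along the digit bijection makes this the expansion of a product of sums over all
    digit functions. *)
Lemma sum_tensmx_digits (f : 'I_k -> 'I_d -> F) :
  \sum_a \prod_i f i (tensmx_digits d k a i) = \prod_i \sum_x f i x.
Proof.
rewrite bigA_distr_bigA /=.
by rewrite (reindex _ (onW_bij _ (tensmx_digits_bij d k))).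
Qed.

Lemma tensmx_fam_mul A B :
  tensmx_fam A *m tensmx_fam B = tensmx_fam (fun i => A i *m B i).
Proof.
apply/matrixP => a b; rewrite mxE tensmx_famE.
under [LHS]eq_bigr => c _ do rewrite !tensmx_famE -big_split /=.
rewrite (sum_tensmx_digits (fun i x =>
  A i (tensmx_digits d k a i) x * B i x (tensmx_digits d k b i))).
by apply: eq_bigr => i _; rewrite mxE.
Qed.

Lemma tensmx_fam_adj A : (tensmx_fam A)^t* = tensmx_fam (fun i => (A i)^t*).
Proof.
apply/matrixP => a b; rewrite !mxE !tensmx_famE rmorph_prod.
by apply: eq_bigr => i _; rewrite !mxE.
Qed.

Lemma mxtrace_tensmx_fam A : \tr (tensmx_fam A) = \prod_i \tr (A i).
Proof.
rewrite -(sum_tensmx_digits (fun i x => A i x x)).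
by apply: eq_bigr => a _; apply: tensmx_famE.
Qed.

Lemma ntensmx_fam (M : 'M[F]_d) : ntensmx M k = tensmx_fam (fun=> M).
Proof.
case: k => [|k']; first by [].
by rewrite /ntensmx /tensmx_fam; elim: k' => //= k' ->.
Qed.

End TensorFamily.

(** * Collapse of the sum over a complete family of operators *)

Section Twirl.
Context {F : numClosedFieldType}.

Lemma mxtrace_tensmx (m n : nat) (A : 'M[F]_m) (B : 'M[F]_n) :
  \tr (A *t B) = \tr A * \tr B.
Proof. by rewrite mulr_sum; apply: eq_bigr => i _; rewrite mxE. Qed.

Lemma prod_tensmx (m n k : nat) (A : 'I_k -> 'M[F]_m) (B : 'I_k -> 'M[F]_n) :
  \prod_i (A i *t B i) = (\prod_i A i) *t (\prod_i B i).
Proof.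
apply/esym; elim/big_rec3: _ => [|i x y z _ <-]; last exact/esym/tensmx_mul.
(* The empty product leaves [1 = 1 *t 1]: two indices agree exactly when both decoded components
   do. *)
apply/matrixP => a b; rewrite !mxE -natrM mulnb; congr (_%:R); congr nat_of_bool.
by rewrite -xpair_eqE (can_eq (@mxtens_unindexK _ _)).
Qed.

(** In the word [u v_0 u v_1 ... u v_k] every inner [v_i u] is a scalar, and cyclicity of the trace
    turns the remaining [u v_k] into [v_k u]. One factor at least is needed: an empty product has
    trace [m], not 1. *)
Lemma mxtrace_prod_rank1 (m k : nat) (u : 'cV[F]_m) (v : 'I_k.+1 -> 'rV[F]_m) :
  \tr (\prod_i (u *m v i)) = \prod_i (v i *m u) ord0 ord0.
Proof.
have -> : \prod_i (u *m v i) =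
    (\prod_(i < k) (v (widen_ord (leqnSn k) i) *m u) ord0 ord0)
      *: (u *m v ord_max).
  elim: k v => [|k IH] v.
    by rewrite big_ord_recl !big_ord0 scale1r mulr1; congr (_ *m v _);
      apply/val_inj.
  rewrite big_ord_recr /= IH [in RHS]big_ord_recr /=.
  rewrite -[LHS]/(_ *m _) -scalemxAl mulmxA -(mulmxA u) [v _ *m u]mx11_scalar.
  by rewrite mul_mx_scalar -scalemxAl scalerA [_%:M _ _]mxE.
by rewrite mxtraceZ mxtrace_mulC trace_mx11 [RHS]big_ord_recr.
Qed.

Definition bell (d : nat) : 'cV[F]_(d * d) :=
  \col_a ((mxtens_unindex a).1 == (mxtens_unindex a).2)%:R.

Lemma sum_bell (d : nat) (f : 'I_(d * d) -> F) :
  \sum_a bell d a ord0 * f a = \sum_i f (mxtens_index (i, i)).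
Proof.
rewrite (reindex (@mxtens_index d d)) /=; last first.
  by apply: onW_bij; exists (@mxtens_unindex d d);
    [apply: mxtens_indexK | apply: mxtens_unindexK].
transitivity (\sum_i \sum_j
    bell d (mxtens_index (i, j)) ord0 * f (mxtens_index (i, j))).
  by rewrite pair_bigA; apply: eq_bigr => -[].
apply: eq_bigr => i _; rewrite (bigD1 i) //= mxE mxtens_indexK eqxx mul1r.
rewrite big1 ?addr0 // => j ji; rewrite mxE mxtens_indexK /= eq_sym.
by rewrite (negbTE ji) mul0r.
Qed.

(** Both sides equal the sum of [V i j * Num.conj (W i j)] over all [i] and [j]. *)
Lemma bell_expectation (d : nat) (V W : 'M[F]_d) :
  ((bell d)^T *m (V *t map_mx Num.conj W) *m bell d) ord0 ord0 = \tr (W^t* *m V).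
Proof.
rewrite mxE; under eq_bigr => a _ do rewrite mulrC [(_ *m _) _ _]mxE.
rewrite sum_bell; apply: eq_bigr => j _.
under eq_bigr => a _ do rewrite [_^T _ _]mxE.
rewrite sum_bell [RHS]mxE; apply: eq_bigr => i _.
by rewrite tensmxE !mxE mulrC.
Qed.

Lemma sum_mxtrace_prod (d k : nat) (S : finType) (P : S -> 'M[F]_d) (c : F)
    (V W : 'I_k.+1 -> 'M[F]_d) :
  (forall a a' b b', \sum_s P s a a' * Num.conj (P s b b')
     = c * ((a == b) && (a' == b'))%:R) ->
  \sum_(A : {ffun 'I_k.+1 -> S})
     Num.conj (\tr (\prod_i (P (A i) *m W i))) * \tr (\prod_i (P (A i) *m V i))
  = c ^+ k.+1 * \prod_i \tr ((W i)^t* *m V i).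
Proof.
move=> complete.
have sumE : \sum_s P s *t map_mx Num.conj (P s) = c *: (bell d *m (bell d)^T).
  apply/matrixP => x y; rewrite summxE !mxE big_ord_recl big_ord0 addr0 !mxE.
  under eq_bigr => s _ do rewrite !mxE.
  by rewrite complete -natrM mulnb.
(* A trace times a conjugated trace is the trace of a tensor product, whose second factor carries
   the conjugates. Expanding the ordered product of sums gives one term for each [A]. *)
transitivity (\tr (\prod_i \sum_s
    ((P s *t map_mx Num.conj (P s)) *m (V i *t map_mx Num.conj (W i))))).
  rewrite bigA_distr_bigA /= raddf_sum; apply: eq_bigr => A _.
  under [in RHS]eq_bigr => i _ do rewrite tensmx_mul -map_mxM.
  rewrite prod_tensmx /= mxtrace_tensmx mulrC; congr (_ * _).
  by rewrite -trace_map_mx -(rmorph_prod (map_mx Num.conj)).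
(* Each factor becomes [u *m v i], with [u = bell d] common to all slots and [c] absorbed into the
   row [v i]. *)
under eq_bigr => i _ do
  rewrite -mulmx_suml sumE -scalemxAl -mulmxA scalemxAr.
rewrite mxtrace_prod_rank1.
under eq_bigr => i _ do rewrite -scalemxAl mxE bell_expectation.
by rewrite big_split prodr_const card_ord.
Qed.

End Twirl.

(** * Completeness and orthogonality of the Paulis, from one qubit to strings *)

Section Pauli.
Context {F : numClosedFieldType}.

(** Divided by the square root of 2, the entries of the four matrices form a unitary 4 by 4 array
    with rows indexed by positions. This is the orthogonality of its rows, [pauli1_orthogonal] that
    of its columns; both are checked case by case. *)
Lemma pauli1_complete (a a' b b' : 'I_2) :
  \sum_t pauli1 F t a a' * Num.conj (pauli1 F t b b')
  = 2%:R * ((a == b) && (a' == b'))%:R.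
Proof.
have ii : 'i * 'i = -1 :> F by rewrite -expr2 sqrCi.
rewrite !big_ord_recl big_ord0 /pauli1 !(tnth_nth 0) /= !mxE.
case: a => [[|[|[]]] //= ?]; case: a' => [[|[|[]]] //= ?];
case: b => [[|[|[]]] //= ?]; case: b' => [[|[|[]]] //= ?];
rewrite -?val_eqE /= ?rmorphN /= ?conjCi ?rmorph0 ?rmorph1;
rewrite ?opprK ?mulrN ?mulNr ?ii; ring.
Qed.

Lemma pauli1_orthogonal (s t : 'I_4) :
  \tr ((pauli1 F s)^t* *m pauli1 F t) = 2%:R * (s == t)%:R.
Proof.
have ii : 'i * 'i = -1 :> F by rewrite -expr2 sqrCi.
rewrite /mxtrace; under eq_bigr => i _ do rewrite mxE.
rewrite !big_ord_recl !big_ord0 /pauli1 !(tnth_nth 0) !mxE.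
case: s => [[|[|[|[|[]]]]] //= ?]; case: t => [[|[|[|[|[]]]]] //= ?];
rewrite !mxE -?val_eqE /= ?rmorphN /= ?conjCi ?rmorph0 ?rmorph1;
rewrite ?opprK ?mulrN ?mulNr ?ii; ring.
Qed.

(** Lifts relations from single qubits to strings ([c = 2]) and from strings to families of strings
    ([c = 2 ^ n]). *)
Lemma prod_eq_ffun (n : nat) (T : eqType) (c : F) (f g : {ffun 'I_n -> T}) :
  \prod_i (c * (f i == g i)%:R) = c ^+ n * (f == g)%:R.
Proof.
rewrite big_split prodr_const card_ord; congr (_ * _).
have [->|fg] := eqVneq f g; first by rewrite big1 // => i _; rewrite eqxx.
have [i fgi] : exists i, f i != g i.
  apply/existsP; apply: contraR fg => /existsPn E.
  by apply/eqP/ffunP => i; apply/eqP/negPn/E.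
by rewrite (bigD1 i) //= (negbTE fgi) mul0r.
Qed.

Lemma pauli_orthogonal (n : nat) (s t : pauli_string n) :
  \tr ((pauli F s)^t* *m pauli F t) = (2 ^ n)%:R * (s == t)%:R.
Proof.
rewrite tensmx_fam_adj tensmx_fam_mul mxtrace_tensmx_fam natrX.
by under eq_bigr => i _ do rewrite pauli1_orthogonal; rewrite prod_eq_ffun.
Qed.

Lemma pauli_complete (n : nat) (a a' b b' : 'I_(2 ^ n)) :
  \sum_(s : pauli_string n) pauli F s a a' * Num.conj (pauli F s b b')
  = (2 ^ n)%:R * ((a == b) && (a' == b'))%:R.
Proof.
under eq_bigr => s _ do rewrite !tensmx_famE rmorph_prod -big_split /=.
set D := tensmx_digits 2 n.
rewrite -(bigA_distr_bigA (fun i t => pauli1 F t (D a i) (D a' i)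
  * Num.conj (pauli1 F t (D b i) (D b' i)))).
under eq_bigr => i _ do rewrite pauli1_complete -mulnb natrM mulrA.
rewrite big_split prod_eq_ffun natrX -mulnb natrM mulrA; congr (_ * _%:R * _).
  by rewrite (inj_eq (tensmx_digits_inj 2 n)).
(* The constant [2 ^ n] went with the row delta, so the column delta is the case [c = 1]. *)
have := prod_eq_ffun n _ 1 (D a') (D b'); rewrite expr1n mul1r.
rewrite (inj_eq (tensmx_digits_inj 2 n)) => <-.
by apply: eq_bigr => i _; rewrite mul1r.
Qed.

End Pauli.

(** * Recovering the channel coefficients from the correlators *)

Lemma kfold_channel_tensmx_fam (R : realType) (d k : nat) (J : finType)
    (p : J -> R) (U : J -> 'M[R[i]]_d) (B : 'I_k -> 'M[R[i]]_d) :
  kfold_channel p U (tensmx_fam B) =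
  \sum_j (p j)%:C *: tensmx_fam (fun i => (U j)^t* *m B i *m U j).
Proof.
by apply: eq_bigr => j _; rewrite !ntensmx_fam !tensmx_fam_mul.
Qed.

Theorem mainTheorem2 (R : realType) (n k : nat) (hk : (1 <= k)%N)
    (J : finType) (p : J -> R) (U : J -> 'M[R[i]]_(2 ^ n))
    (hp0 : forall j, 0 <= p j) (hp1 : \sum_j p j = 1)
    (hU : forall j, U j \is unitarymx)
    (B : 'I_k -> pauli_string n)
    (gamma : {ffun 'I_k -> pauli_string n} -> R[i])
    (hgamma : kfold_channel p U (tensmx_fam (fun i => pauli R[i] (B i))) =
      \sum_(C : {ffun 'I_k -> pauli_string n})
        gamma C *: tensmx_fam (fun i => pauli R[i] (C i))) :
  let d := (2 ^ n)%N in
  let alpha (A : {ffun 'I_k -> pauli_string n}) : R[i] :=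
    otoc p U (fun i => pauli R[i] (A i)) (fun i => pauli R[i] (B i)) in
  forall C : {ffun 'I_k -> pauli_string n},
    gamma C = (d%:R ^+ (2 * k - 1))^-1 *
      \sum_(A : {ffun 'I_k -> pauli_string n})
        Num.conj (\tr (\prod_(i < k) (pauli R[i] (A i) *m pauli R[i] (C i))))
          * alpha A.
Proof.
move=> d alpha C; pose V j i := (U j)^t* *m pauli R[i] (B i) *m U j.
have dn0 : d%:R != 0 :> R[i] by rewrite pnatr_eq0 expn_eq0.
(* Pairing both sides of [hgamma] with the tensor product of the Paulis [C i] isolates [gamma C],
   since each slot contributes [d] or 0. *)
have gammaE : d%:R ^+ k * gamma C =
    \sum_j (p j)%:C * \prod_i \tr ((pauli R[i] (C i))^t* *m V j i).
  have := congr1 (fun M =>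
    \tr ((tensmx_fam (fun i => pauli R[i] (C i)))^t* *m M)) hgamma.
  rewrite kfold_channel_tensmx_fam !mulmx_sumr !raddf_sum /= tensmx_fam_adj.
  under eq_bigr => j _ do
    rewrite -scalemxAr mxtraceZ tensmx_fam_mul mxtrace_tensmx_fam.
  move=> ->; rewrite (bigD1 C) //= big1 => [|C' C'C].
    rewrite addr0 -scalemxAr mxtraceZ tensmx_fam_mul mxtrace_tensmx_fam.
    under eq_bigr => i _ do rewrite pauli_orthogonal.
    by rewrite prod_eq_ffun eqxx mulr1 mulrC.
  rewrite -scalemxAr mxtraceZ tensmx_fam_mul mxtrace_tensmx_fam.
  under eq_bigr => i _ do rewrite pauli_orthogonal.
  by rewrite prod_eq_ffun eq_sym (negbTE C'C) !mulr0.
(* The factor [d^-1] is the trace normalisation in [otoc], the first [d ^ k] comes from Pauli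
   completeness, and the second from [gammaE]. *)
have -> : \sum_(A : {ffun 'I_k -> pauli_string n})
    Num.conj (\tr (\prod_(i < k) (pauli R[i] (A i) *m pauli R[i] (C i)))) * alpha A
    = d%:R^-1 * d%:R ^+ k * (d%:R ^+ k * gamma C).
  rewrite gammaE mulr_sumr; under eq_bigr => A _ do rewrite mulr_sumr.
  rewrite exchange_big; apply: eq_bigr => j _.
  case: k hk B gamma hgamma @alpha C @V gammaE => // k' _ B gamma _ _ C V _.
  transitivity ((p j)%:C * d%:R^-1 * (d%:R ^+ k'.+1 *
      \prod_i \tr ((pauli R[i] (C i))^t* *m V j i))); last by ring.
  rewrite -(sum_mxtrace_prod _ _ _ _ _ (V j) (fun i => pauli R[i] (C i))
    (pauli_complete n)).
  by rewrite mulr_sumr; apply: eq_bigr => A _; ring.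
(* The subtraction is on natural numbers; [hk] keeps it from truncating. *)
have -> : d%:R ^+ (2 * k - 1) = d%:R^-1 * d%:R ^+ k * d%:R ^+ k :> R[i].
  rewrite -mulrA -exprD addnn -mul2n -(prednK hk) mulnS add2n subn1 /=.
  by rewrite [in RHS]exprS mulKf.
by rewrite (mulrA _ (_ ^+ k)) mulKf // !mulf_neq0 ?invr_eq0 ?expf_neq0.
Qed.
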